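(* Let $S^2$ be the boundary of the closed unit ball $B^3\subset\mathbb{R}^3$. Suppose that $a>0$ and $f:S^2\to[0,a]$ is a countable-to-one function. Then for all $n\in\mathbb{N}$ the set $$\mathcal{NM}^n_f=\left\{x\in S^2\mid \text{there exists } y\in S^2 \text{ such that } f(x)-f(y)>n\,d_E(x,y)\right\}$$ is uncountable.
   Context: $d_E$ denotes the Euclidean metric on $\mathbb{R}^3$, and $\mathbb{N}$ is the set of positive integers. A function $f$ is countable-to-one if $f^{-1}(t)$ is countable (finite, possibly empty, or countably infinite) for every $t$. No continuity of $f$ is assumed. *)

(* Defs.v *)
From HB Require Import structures.
From mathcomp Require Import all_boot all_order all_algebra.
From mathcomp Require Import all_classical all_reals all_analysis.

Set Implicit Arguments.
Unset Strict Implicit.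
Unset Printing Implicit Defensive.

Import Order.TTheory GRing.Theory Num.Theory.
Import numFieldNormedType.Exports.

Local Open Scope classical_set_scope.
Local Open Scope ring_scope.

(* The library norm `|x| on 'rV[R]_n is the sup norm, hence the explicit
   Euclidean norm; both induce the product topology carried by 'rV[R]_n. *)
Definition enorm (R : realType) (n : nat) (x : 'rV[R]_n) : R :=
  Num.sqrt (\sum_(i < n) x ord0 i ^+ 2).

Definition edist (R : realType) (n : nat) (x y : 'rV[R]_n) : R :=
  enorm (x - y).

Definition boundary (T : topologicalType) (A : set T) : set T :=
  closure A `\` interior A.

Definition B3 (R : realType) : set 'rV[R]_3 := closed_ball_ (@enorm R 3) 0 1.

Definition S2 (R : realType) : set 'rV[R]_3 := boundary (@B3 R).

(* Maps A -> B are encoded as total functions on T that send A into B; their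
   values outside A are irrelevant, so fibres are taken inside A. *)
Definition countable_to_one (T U : Type) (A : set T) (f : T -> U) : Prop :=
  forall t : U, countable (A `&` f @^-1` [set t]).

Definition NM (R : realType) (f : 'rV[R]_3 -> R) (n : nat) : set 'rV[R]_3 :=
  [set x | S2 x /\ exists2 y, S2 y & f x - f y > n%:R * edist x y].

(* Main.v *)
Require Import Defs.
From mathcomp Require Import all_boot all_order all_algebra.
From mathcomp Require Import all_classical all_reals all_analysis.
From mathcomp Require Import ring lra.

Import Order.TTheory GRing.Theory Num.Theory.
Import numFieldNormedType.Exports.
(* From here on [edist] is the Euclidean distance, and not the extended distance
   of a pseudometric space. *)
Import Defs.

Local Open Scope classical_set_scope.
Local Open Scope ring_scope.

(** Suppose that [NM f n] is countable. Off this set [f] is [n]-Lipschitz for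
    the Euclidean distance, whatever its behaviour on the set itself. Slice a
    piece of the upper hemisphere by the horizontal arcs
    [arc z t = (t, sqrt (1 - z^2 - t^2), z)], with [z] and [t] in [[0, 1/2]].
    These arcs are pairwise disjoint, so all but countably many of them avoid
    [NM f n]. Along such an arc [f] is continuous ([lipschitz_arc_continuous]),
    and it is not constant because an arc is uncountable while the fibres of
    [f] are countable; by the intermediate value theorem it takes a rational
    value there ([arc_rational_value]).

    Hence every height [z] in [[0, 1/2]] is the third coordinate of a point of
    [NM f n] or of a point of one of the countably many fibres of [f] over the
    rationals. All of these sets are countable, whereas [[0, 1/2]] is not. *)

Lemma countableU {T : Type} (A B : set T) :
  countable A -> countable B -> countable (A `|` B).
Proof.
by move=> cA cB; rewrite -bigcup2E; apply: bigcup_countable => // -[|[|i]].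
Qed.

Lemma countable_image {T U : Type} (g : T -> U) {A : set T} :
  countable A -> countable (g @` A).
Proof. exact/sub_countable/card_image_le. Qed.

Lemma uncountable_itvcc {R : realType} {u v : R} :
  u < v -> ~ countable `[u, v]%classic.
Proof.
move=> uv /countable_lebesgue_measure0.
rewrite lebesgue_measure_itv/= lte_fin uv -EFinB => /eqP.
by rewrite eqe subr_eq0 gt_eqF.
Qed.

Lemma enormZ {R : realType} (n : nat) (r : R) (x : 'rV[R]_n) :
  enorm (r *: x) = `|r| * enorm x.
Proof.
rewrite /enorm -sqrtr_sqr -sqrtrM ?sqr_ge0// mulr_sumr.
by congr Num.sqrt; apply: eq_bigr => i _; rewrite mxE exprMn.
Qed.

Lemma edistC {R : realType} (n : nat) (x y : 'rV[R]_n) :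
  edist x y = edist y x.
Proof. by rewrite /edist -opprB -scaleN1r enormZ normrN1 mul1r. Qed.

(** A point of norm [1] lies in the closed ball, but the points [r *: x] with
    [r > 1] are outside it and tend to [x] as [r] tends to [1]. *)
Lemma enorm1_S2 {R : realType} (x : 'rV[R]_3) : enorm x = 1 -> S2 x.
Proof.
move=> x1; have B3E y : @B3 R y = (enorm y <= 1) :> Prop.
  by rewrite /B3 /closed_ball_/= sub0r -scaleN1r enormZ normrN1 mul1r.
split; first by apply: subset_closure; rewrite B3E x1.
move=> intx.
have cx : (r *: x) @[r --> (1 : R)] --> x.
  rewrite -[X in _ --> X]scale1r.
  exact: cvgZr_tmp cvg_id.
have : \forall r \near (1 : R), @B3 R (r *: x) by exact: cx.
move=> /nbhs_ballP[e /= e0 /(_ (1 + e / 2))].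
rewrite B3E enormZ x1 mulr1 /ball/= opprD addrA subrr sub0r normrN.
rewrite ger0_norm ?divr_ge0 ?(ltW e0)// ger0_norm; last by lra.
by move=> /(_ ltac:(lra)); lra.
Qed.

(** The definition of [NM f n] is one-sided: [x] off it bounds [f x - f y] and
    [y] off it bounds [f y - f x], hence two points are needed off it. *)
Lemma lipschitz_off_NM {R : realType} (f : 'rV[R]_3 -> R) (n : nat)
    (x y : 'rV[R]_3) :
  S2 x -> S2 y -> ~ NM f n x -> ~ NM f n y ->
  `|f x - f y| <= n%:R * edist x y.
Proof.
move=> Sx Sy Nx Ny; rewrite ler_norml; apply/andP; split.
- rewrite lerNl opprB leNgt; apply/negP => lt_yx.
  by apply: Ny; split=> //; exists x => //; rewrite edistC.
- rewrite leNgt; apply/negP => lt_xy.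
  by apply: Nx; split=> //; exists y.
Qed.

Section Arcs.
Context {R : realType}.
Implicit Types (z s t : R) (f : 'rV[R]_3 -> R).

(** Compared with a trigonometric parametrization of the parallel at height
    [z], this graph makes both parameters coordinates of the point, so that
    disjointness and injectivity need no argument. *)
Definition arc z t : 'rV[R]_3 :=
  \row_(i < 3) [:: t; Num.sqrt (1 - z ^+ 2 - t ^+ 2); z]`_i.

Let fst3 (x : 'rV[R]_3) : R := x ord0 ord0.
Let thd3 (x : 'rV[R]_3) : R := x ord0 ord_max.

Let fst3_arc z t : fst3 (arc z t) = t. Proof. by rewrite /fst3 mxE. Qed.
Let thd3_arc z t : thd3 (arc z t) = z. Proof. by rewrite /thd3 mxE. Qed.

Lemma arc_S2 z t : `[0, 1/2]%classic z -> `[0, 1/2]%classic t -> S2 (arc z t).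
Proof.
rewrite /= !in_itv/= => /andP[z0 z1] /andP[t0 t1]; apply: enorm1_S2.
rewrite /enorm !big_ord_recr big_ord0 /= !mxE/= sqr_sqrtr; last by nra.
by rewrite -[RHS]sqrtr1; congr Num.sqrt; ring.
Qed.

Lemma arc_edist_cvg0 z s : edist (arc z s) (arc z t) @[t --> s] --> (0 : R).
Proof.
have -> : (fun t => edist (arc z s) (arc z t)) = (fun t =>
    Num.sqrt ((s - t) ^+ 2 + (Num.sqrt (1 - z ^+ 2 - s ^+ 2) -
                              Num.sqrt (1 - z ^+ 2 - t ^+ 2)) ^+ 2)).
  apply/funext => t; rewrite /edist /enorm !big_ord_recr big_ord0 /= !mxE/=.
  by congr Num.sqrt; ring.
set h := (fun t => _).
have <- : h s = 0 by rewrite /h !subrr expr0n addr0 sqrtr0.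
have ch c : continuous (fun t : R => Num.sqrt (c - t ^+ 2)).
  move=> t; apply: (@continuous_comp _ _ _ (fun t => c - t ^+ 2) Num.sqrt).
    by apply: continuousB; [exact: cst_continuous | exact: exprn_continuous].
  exact: sqrt_continuous.
have cX (g : R -> R) c : continuous g -> continuous (fun t => (c - g t) ^+ 2).
  move=> cg t; apply: (@continuous_comp _ _ _ (fun t => c - g t)
    (fun x => x ^+ 2)).
    by apply: continuousB; [exact: cst_continuous | exact: cg].
  exact: exprn_continuous.
apply: (@continuous_comp _ _ _ (fun t => _ + _) (@Num.sqrt R)).
  apply: (@continuousD _ _ _ (fun t => (s - t) ^+ 2)
    (fun t => (_ - Num.sqrt (_ - t ^+ 2)) ^+ 2)).
    by apply: (cX id) => t; exact: cvg_id.
  exact/cX/ch.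
exact: sqrt_continuous.
Qed.

Lemma lipschitz_arc_continuous f (k : R) z (A : set R) :
  {in A &, forall s t, `|f (arc z s) - f (arc z t)|
                         <= k * edist (arc z s) (arc z t)} ->
  {within A, continuous (f \o arc z)}.
Proof.
move=> fk; apply/subspace_continuousP => s As.
apply/cvgrPdist_le => e e0.
have cvg0 : k * edist (arc z s) (arc z t) @[t --> s] --> (0 : R).
  rewrite -[X in _ --> X](mulr0 k).
  by apply: cvgM; [exact: cvg_cst | exact: arc_edist_cvg0].
move/cvgrPdist_le: cvg0 => /(_ _ e0) near0.
rewrite near_withinE; near=> t => At /=.
apply: le_trans (fk _ _ (mem_set As) (mem_set At)) _.
apply: le_trans (ler_norm _) _; rewrite -normrN -sub0r.
by near: t.
Unshelve. all: by end_near. Qed.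

Lemma arc_rational_value {f} {n : nat} {z} :
  countable_to_one (@S2 R) f -> `[0, 1/2]%classic z ->
  ~ (thd3 @` NM f n) z ->
  exists q : rat, exists2 t, `[0, 1/2]%classic t & f (arc z t) = ratr q.
Proof.
move=> f_ctbl Iz zN.
have arcN t : ~ NM f n (arc z t).
  by move=> Nt; apply: zN; exists (arc z t); rewrite ?thd3_arc.
have fcont (u v : R) : 0 <= u -> v <= 1/2 ->
    {within `[u, v], continuous (f \o arc z)}.
  move=> u0 v1; have sub t : t \in `[u, v]%classic -> `[0, 1/2]%classic t.
    by rewrite inE/= !in_itv/= => /andP[ut tv]; apply/andP; split; lra.
  apply: (@lipschitz_arc_continuous f n%:R z) => s t /sub Is /sub It.
  by apply: lipschitz_off_NM => //; exact: arc_S2.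
have [u [v [Iu Iv uv fuv]]] : exists u v : R, [/\ `[0, 1/2]%classic u,
    `[0, 1/2]%classic v, u < v & f (arc z u) <> f (arc z v)].
  (* Otherwise the whole arc lies in the fibre of [f] through [arc z 0]. *)
  have I0 : `[0, 1/2]%classic (0 : R) by rewrite /= in_itv/=; lra.
  apply: contrapT => cst; have hI : (0 : R) < 1/2 by lra.
  apply: (uncountable_itvcc hI).
  apply: sub_countable (countable_image fst3 (f_ctbl (f (arc z 0)))).
  apply: subset_card_le => t It; exists (arc z t); last exact: fst3_arc.
  split; first exact: arc_S2.
  apply: contrapT => /= ft; apply: cst; exists 0, t; split => //.
    move: It; rewrite /= in_itv/= => /andP[].
    rewrite le_eqVlt => /predU1P[t0|//].
    by rewrite -t0 in ft.
  by move=> e; exact: ft.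
move: (Iu) (Iv); rewrite /= !in_itv/= => /andP[u0 u1] /andP[v0 v1].
have : Num.min (f (arc z u)) (f (arc z v)) <
       Num.max (f (arc z u)) (f (arc z v)).
  by rewrite gt_min !lt_max !ltxx orbF/= -neq_lt; apply/eqP.
move=> /rat_in_itvoo[q]; rewrite in_itv/= => /andP[/ltW mq /ltW qM].
have [t] := IVT (ltW uv) (fcont _ _ u0 v1) (introT andP (conj mq qM)).
rewrite in_itv/= => /andP[ut tv] ft; exists q, t => //.
by rewrite /= in_itv/=; apply/andP; split; lra.
Qed.

(** Every height is accounted for by a point of [NM f n] or by a point where
    [f] is rational, so these two sets cannot both be countable. *)
Lemma uncountable_NM f (n : nat) :
  countable_to_one (@S2 R) f -> ~ countable (NM f n).
Proof.
move=> f_ctbl NM_ctbl; have hI : (0 : R) < 1/2 by lra.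
apply: (uncountable_itvcc hI).
pose Q : set 'rV[R]_3 := \bigcup_(q : rat) (@S2 R `&` f @^-1` [set ratr q]).
have Q_ctbl : countable Q.
  by apply: bigcup_countable => [|q _]; [exact: countableP | exact: f_ctbl].
have cover : `[0, 1/2]%classic `<=` (thd3 @` NM f n) `|` (thd3 @` Q).
  move=> z Iz; have [|zN] := pselect ((thd3 @` NM f n) z); first by left.
  have [q [t It ft]] := arc_rational_value f_ctbl Iz zN.
  right; exists (arc z t); last exact: thd3_arc.
  by exists q => //; split; first exact: arc_S2.
apply: (sub_countable (subset_card_le cover)).
by apply: countableU; exact: countable_image.
Qed.

End Arcs.

Theorem theorem3p1 (R : realType) (a : R) (a_gt0 : 0 < a)
    (f : {fun (@S2 R) >-> `[0, a]%classic})
    (f_ctbl : countable_to_one (@S2 R) f) (n : nat) (n_gt0 : (0 < n)%N) :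
  ~ countable (NM f n).
Proof. exact: uncountable_NM. Qed.
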